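(* The following three statements hold. (1) Let $\beta\in(1,\beta_{KL})$. Then every $x\in(0,\frac{1}{\beta-1})$ has a simply normal $\beta$-expansion. (2) Let $\beta\in(1,\frac{1+\sqrt5}{2})$. Then every $x\in(0,\frac{1}{\beta-1})$ has a $\beta$-expansion for which the frequency of zeros does not exist. (3) Let $\beta\in(1,\frac{1+\sqrt5}{2})$. Then there exists $c=c(\beta)>0$ such that for every $x\in(0,\frac{1}{\beta-1})$ and every $p\in[1/2-c,1/2+c]$ there exists a $\beta$-expansion of $x$ with frequency of zeros equal to $p$.
   Context: For $\beta\in(1,2)$ and $x\in\mathbb{R}$, a sequence $(\epsilon_i)_{i\ge1}\in\{0,1\}^{\mathbb{N}}$ is called a $\beta$-expansion of $x$ if $x=\sum_{i=1}^{\infty}\epsilon_i\beta^{-i}$. The frequency of zeros of $(\epsilon_i)\in\{0,1\}^{\mathbb{N}}$ is the limit $\mathrm{freq}_0(\epsilon_i):=\lim_{n\to\infty}\frac{\#\{1\le i\le n:\epsilon_i=0\}}{n}$, if this limit exists; otherwise the frequency of zeros does not exist. The sequence is simply normal if $\mathrm{freq}_0(\epsilon_i)=1/2$. $\beta_{KL}\approx1.787$ is the Komornik-Loreti constant: the smallest $\beta\in(1,2)$ for which $1$ has a unique $\beta$-expansion. Equivalently, it is the unique $\beta\in(1,2)$ with $1=\sum_{i=1}^{\infty}\tau_i\beta^{-i}$, where $(\tau_i)_{i=0}^{\infty}=0110\,1001\,1001\,0110\cdots$ is the Thue-Morse sequence, i.e. the limit of the words $\tau^0=0$, $\tau^{k+1}=\tau^k\overline{\tau^k}$,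 with $\overline{\tau^k}$ obtained from $\tau^k$ by exchanging $0$ and $1$. *)

(* Defs.v *)
From HB Require Import structures.
From mathcomp Require Import all_boot all_order all_algebra.
From mathcomp Require Import all_classical all_reals all_analysis.
Import Order.TTheory GRing.Theory Num.Theory.
Import numFieldNormedType.Exports.

Set Implicit Arguments.
Unset Strict Implicit.
Unset Printing Implicit Defensive.

Local Open Scope classical_set_scope.
Local Open Scope ring_scope.

(* Sequences in {0,1}^N are boolean and indexed from 0: the digit epsilon_i,
   i >= 1, is [eps i.-1]. *)
Definition beta_expansion (R : realType) (beta x : R) (eps : nat -> bool) :
    Prop :=
  (fun n : nat => \sum_(i < n) (eps i)%:R * beta ^- i.+1) @ \oo --> x.

(* The value at n = 0 is 0 / 0 = 0 and plays no role in the limit. *)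
Definition zeros_ratio (R : realType) (eps : nat -> bool) (n : nat) : R :=
  #|[set i : 'I_n | eps i == false]%SET|%:R / n%:R.

Definition freq0_is (R : realType) (eps : nat -> bool) (p : R) : Prop :=
  zeros_ratio R eps @ \oo --> p.

Definition freq0_exists (R : realType) (eps : nat -> bool) : Prop :=
  exists p : R, freq0_is eps p.

Definition simply_normal (R : realType) (eps : nat -> bool) : Prop :=
  freq0_is eps (2^-1 : R).

Definition univoque_bases (R : realType) : set R :=
  [set beta : R | 1 < beta < 2 /\
                  exists! eps : nat -> bool, beta_expansion beta 1 eps].

Arguments univoque_bases : clear implicits.

(* By a theorem of Komornik and Loreti [univoque_bases] has a least element,
   which is therefore its infimum, see [beta_KL_least]. *)
Definition beta_KL (R : realType) : R := inf (univoque_bases R).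

Lemma beta_KL_least (R : realType) (b : R) :
  univoque_bases R b -> (forall b' : R, univoque_bases R b' -> b <= b') ->
  beta_KL R = b.
Proof.
move=> Ub minb; apply/eqP; rewrite eq_le; apply/andP; split.
  by apply: ge_inf => //; exists b.
by apply: lb_le_inf; [exists b|].
Qed.

Definition golden_ratio (R : realType) : R := (1 + Num.sqrt 5) / 2.

(* Main.v *)
Require Import Defs.
From mathcomp Require Import all_boot all_order all_algebra.
From mathcomp Require Import all_classical all_reals all_analysis.
From mathcomp Require Import ring lra.
Import Order.TTheory GRing.Theory Num.Theory.
Import numFieldNormedType.Exports.

(** Put [L = 1 / (beta - 1)] and centre the interval: with [z = 2 x - L] and
    digits [d = 1] or [d = -1] in place of 1 and 0, an expansion of [x] is a
    choice of digits that keeps the orbit [z' = beta z - d] bounded, and the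
    frequency of zeros is [p] exactly when the digit sums [S_n] satisfy
    [S_n / n --> 1 - 2 p].

    The digits are chosen by a threshold rule: take [1] when [t <= z] and [-1]
    otherwise; the reflected rule at [z] does to [z] what this rule does to
    [- z].  Suppose that on the region where the orbit lives there is a bounded
    function [D] such that each step of the threshold rule satisfies
    [D z' <= D z + d - q].  Then [S_n - q n] is bounded below along the rule,
    and the reflected rule keeps [S_n + q n] bounded above.  So for every target
    [g] that moves by at most [q] per step, using the rule while [S_n < g n] and
    the reflected rule otherwise keeps [S_n - g n] bounded ([steering]).

    For [beta < (1 + sqrt 5) / 2] such a [D] exists with some [q > 0]
    ([drifting_potential]); a linear target then gives all frequencies near 1/2,
    and a multiple of the distance to the set of powers of 2 gives an expansion
    without frequency.

    For the simply normal expansions [q = 0] and [g = 0] suffice.  The potential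
    ([balanced_potential]) exists as long as
    [beta ^ 3 - beta ^ 2 - 2 beta + 1 < 0], a range that contains the bases
    below the Komornik-Loreti constant: the root [r] of this cubic in [(1, 2)]
    is itself a univoque base, 1 having the only expansion
    [1 1 0 1 0 1 0 1 ...] in it ([univoque_base_cubic]), so [beta_KL <= r]. *)

Set Implicit Arguments.
Unset Strict Implicit.
Unset Printing Implicit Defensive.

Local Open Scope classical_set_scope.
Local Open Scope ring_scope.

(** * Digits, orbits and expansions *)

Definition sgd (R : realType) (b : bool) : R := if b then 1 else -1.

Definition excess (R : realType) (eps : nat -> bool) (n : nat) : R :=
  \sum_(i < n) sgd R (eps i).

(** A bounded [D] with this property is a certificate that the threshold rule
    produces digits of mean at least [q]: summing the inequality along an orbit
    that stays in [[-M, M]] telescopes [D]. *)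
Definition drift_potential (R : realType) (beta t q M : R) : Prop :=
  exists (D : R -> R) (B : R),
    (forall z : R, `|z| <= M -> `|D z| <= B) /\
    (forall z : R, `|z| <= M ->
       D (beta * z - sgd R (t <= z)) <= D z + sgd R (t <= z) - q).

(** The partial sums miss [x 0] by [x n / beta ^ n]. *)
Lemma orbit_beta_expansion (R : realType) (beta : R) (eps : nat -> bool)
    (x : nat -> R) (C : R) :
  1 < beta -> (forall n, x n.+1 = beta * x n - (eps n)%:R) ->
  (forall n, `|x n| <= C) -> beta_expansion beta (x 0%N) eps.
Proof.
move=> b1 xS xC.
have b0 : beta != 0 by rewrite gt_eqF//; lra.
have xE n : \sum_(i < n) (eps i)%:R * beta ^- i.+1 = x 0%N - x n * beta ^- n.
  elim: n => [|n IH]; first by rewrite big_ord0 expr0 invr1 mulr1 subrr.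
  rewrite big_ord_recr /= IH xS exprSr.
  have bn : beta ^+ n != 0 by rewrite expf_neq0.
  by field; rewrite b0 bn.
rewrite /beta_expansion.
under eq_fun do rewrite xE.
suff x0 : (fun n => x n * beta ^- n) @ \oo --> (0 : R).
  by have := cvgB (cvg_cst (x 0%N)) x0; rewrite subr0; apply.
have Cb : (fun n => C * beta^-1 ^+ n) @ \oo --> (0 : R).
  suff H : (fun n => beta^-1 ^+ n) @ \oo --> (0 : R).
    by have := cvgM (cvg_cst C) H; rewrite mulr0; apply.
  apply: cvg_expr; rewrite ger0_norm ?invr_ge0; last lra.
  by rewrite invf_lt1//; lra.
apply: (@squeeze_cvgr _ _ _ _ (fun n => - (C * beta^-1 ^+ n)) (fun n => C * beta^-1 ^+ n)) => //.
  apply: nearW => n; rewrite -ler_norml normrM exprVn.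
  have bp : 0 <= beta ^- n by rewrite invr_ge0 exprn_ge0//; lra.
  by rewrite (ger0_norm bp) ler_wpM2r.
by rewrite -oppr0; exact: cvgN.
Qed.

(** The scaled remainders form the orbit.  They lie in [[0, 1 / (beta - 1)]]
    because the partial sums increase to [x], while the partial sums completed
    by the largest possible tail decrease to [x]. *)
Lemma beta_expansion_orbit (R : realType) (beta x : R) (eps : nat -> bool) :
  1 < beta -> beta_expansion beta x eps ->
  exists y : nat -> R, [/\ y 0%N = x, forall n, y n.+1 = beta * y n - (eps n)%:R
    & forall n, 0 <= y n <= (beta - 1)^-1].
Proof.
move=> b1 ex.
have b0 : 0 < beta by lra.
have bL : (beta - 1) * (beta - 1)^-1 = 1 by rewrite divff//; lra.
set L := (beta - 1)^-1 in bL *.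
pose P n : R := \sum_(i < n) (eps i)%:R * beta ^- i.+1.
have PS n : P n.+1 = P n + (eps n)%:R * beta ^- n.+1 by rewrite /P big_ord_recr.
have bn0 n : 0 < beta ^+ n by rewrite exprn_gt0.
have Pcvg : P @ \oo --> x by exact: ex.
have bS n : beta ^- n.+1 = beta ^- n / beta :> R by rewrite exprSr invfM mulrC.
have Plo n : P n <= x.
  rewrite -(cvg_lim _ Pcvg)//; apply: nondecreasing_cvgn_le; last by apply/cvg_ex; exists x.
  apply/nondecreasing_seqP => k; rewrite PS lerDl mulr_ge0// invr_ge0 ltW//.
pose Q n : R := P n + L * beta^-1 ^+ n.
have Qcvg : Q @ \oo --> x.
  rewrite -[x]addr0; apply: cvgD => //.
  suff H : (fun n => beta^-1 ^+ n) @ \oo --> (0 : R).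
    by have := cvgM (cvg_cst L) H; rewrite mulr0; apply.
  apply: cvg_expr; rewrite ger0_norm ?invr_ge0; last lra.
  by rewrite invf_lt1//; lra.
have Qhi n : x <= Q n.
  rewrite -(cvg_lim _ Qcvg)//; apply: nonincreasing_cvgn_ge; last by apply/cvg_ex; exists x.
  apply/nonincreasing_seqP => k; rewrite /Q PS -addrA lerD2l !exprVn.
  have {1}-> : beta ^- k = beta * beta ^- k.+1 :> R.
    by rewrite bS mulrC divfK// gt_eqF.
  rewrite mulrA -mulrDl ler_wpM2r ?invr_ge0 ?(ltW (bn0 _))//.
  by case: (eps k) => /=; lra.
exists (fun n => beta ^+ n * (x - P n)); split=> [|n|n].
- by rewrite /P big_ord0 expr0 mul1r subr0.
- rewrite PS exprS; field; rewrite gt_eqF//= gt_eqF//.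
- rewrite mulr_ge0 ?subr_ge0 ?(ltW (bn0 n))//=.
  have := Qhi n; rewrite /Q exprVn -lerBlDl => H.
  have := ler_wpM2l (ltW (bn0 n)) H.
  by rewrite [X in _ <= X]mulrCA divff ?mulr1 ?gt_eqF.
Qed.

(** * Steering the digit sums *)

(** The invariant is [D z - C <= S - g] together with its mirror image
    [D (- z) - C <= g - S].  The active rule preserves its own half by the
    inequality on [D]; the other half is not tight, since the sign of [S - g]
    that selects the rule leaves it a margin [C] against one step.
    The potential is needed for every [M] because the orbit region has to
    contain the starting point, which may be arbitrarily close to the end
    points of the interval. *)
Lemma steering (R : realType) (beta t q : R) (g : nat -> R) (x : R) :
  1 < beta -> 0 <= t -> 0 <= q -> (beta - 1) * (beta * t + 1) < 1 ->
  (forall M : R, beta * t + 1 <= M -> (beta - 1) * M < 1 ->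
     drift_potential beta t q M) ->
  g 0%N = 0 -> (forall n, `|g n.+1 - g n| <= q) ->
  0 < x < (beta - 1)^-1 ->
  exists eps : nat -> bool, beta_expansion beta x eps /\
    exists C : R, forall n, `|excess R eps n - g n| <= C.
Proof.
move=> b1 t0 q0 tL pot g0 gL xL.
have bL : (beta - 1) * (beta - 1)^-1 = 1 by rewrite divff//; lra.
(* a region that contains both the starting point and the image of [t] under
   the digit -1 *)
have [M [tM ML xM]] : exists M : R, [/\ beta * t + 1 <= M, (beta - 1) * M < 1
    & `|2 * x - (beta - 1)^-1| <= M].
  exists (Num.max (beta * t + 1) `|2 * x - (beta - 1)^-1|).
  split; [by rewrite le_max lexx| |by rewrite le_max lexx orbT].
  rewrite -[X in _ < X]bL ltr_pM2l; last lra.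
  rewrite gt_max -(ltr_pM2l (x := beta - 1)) ?bL; last lra.
  by rewrite tL ltr_norml; move: xL => /andP[? ?]; apply/andP; split; lra.
have [D [B [DB Dd]]] := pot _ tM ML.
(* the state is the pair of the orbit point and the digit sum *)
pose dig n (s : R * R) := if s.2 < g n then t <= s.1 else ~~ (t <= - s.1).
pose step n s := (beta * s.1 - sgd R (dig n s), s.2 + sgd R (dig n s)).
pose st := fix st n := if n is k.+1 then step k (st k) else (2 * x - (beta - 1)^-1, 0).
pose eps n := dig n (st n).
have st2 n : (st n).2 = excess R eps n.
  rewrite /excess; elim: n => [|n IH] /=; first by rewrite big_ord0.
  by rewrite big_ord_recr /= -IH.
pose C := B + 1 + q.
(* the region is invariant since [beta M - 1 <= M] and [beta t + 1 <= M] *)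
have stay (z : R) : `|z| <= M -> `|beta * z - sgd R (t <= z)| <= M.
  rewrite !ler_norml /sgd => /andP[z1 z2].
  have bt : 0 <= beta * t by rewrite mulr_ge0//; lra.
  case: (leP t z) => tz; apply/andP.
    have bz : 0 <= beta * (M - z) by rewrite mulr_ge0//; lra.
    have btz : 0 <= beta * (z - t) by rewrite mulr_ge0//; lra.
    by split; lra.
  have bz : 0 <= beta * (M + z) by rewrite mulr_ge0//; lra.
  have btz : 0 <= beta * (t - z) by rewrite mulr_ge0//; lra.
  by split; lra.
have sgN b : sgd R (~~ b) = - sgd R b by case: b; rewrite /sgd ?opprK.
have sg1 b : -1 <= sgd R b <= 1 by case: b; rewrite /sgd; apply/andP; split; lra.
have inv n : [/\ `|(st n).1| <= M, D (st n).1 - C <= (st n).2 - g n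
               & D (- (st n).1) - C <= g n - (st n).2].
  elim: n => [|n [IM I1 I2]] /=.
    rewrite g0; split => //.
      by have := DB _ xM; rewrite ler_norml /C => /andP[_ ?]; lra.
    rewrite -normrN in xM.
    by have := DB _ xM; rewrite ler_norml /C => /andP[_ ?]; lra.
  have := gL n; rewrite ler_norml => /andP[g1 g2].
  rewrite /step /dig /=; move: (st n) IM I1 I2 => [z S] /= IM I1 I2.
  case: ltP => Sg.
    have Mz' := stay _ IM; split => //.
      by have := Dd _ IM; lra.
    move: Mz'; rewrite -normrN => Mz'.
    have := DB _ Mz'; rewrite ler_norml => /andP[_].
    by have /andP[] := sg1 (t <= z); rewrite /C; lra.
  move: IM; rewrite -normrN => IM; have Mz' := stay _ IM.
  have zE : beta * z - sgd R (~~ (t <= - z)) = - (beta * - z - sgd R (t <= - z)).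
    by rewrite sgN; ring.
  rewrite zE opprK; split; first by rewrite normrN.
    move: Mz'; rewrite -normrN => Mz'.
    have := DB _ Mz'; rewrite ler_norml => /andP[_].
    by have /andP[] := sg1 (~~ (t <= - z)); rewrite /C; lra.
  by have := Dd _ IM; rewrite sgN; lra.
exists eps; split; last first.
  exists (B + C) => n; rewrite -st2.
  have [IM I1 I2] := inv n.
  have IN := IM; rewrite -normrN in IN.
  have := DB _ IM; have := DB _ IN; rewrite !ler_norml => /andP[? _] /andP[? _].
  by apply/andP; split; lra.
(* back from the centred coordinate to the original one *)
pose y n := ((st n).1 + (beta - 1)^-1) / 2.
have -> : x = y 0%N by rewrite /y /=; lra.
apply: (@orbit_beta_expansion _ _ _ _ ((M + (beta - 1)^-1) / 2)) => // n.
  rewrite /y /= -/(eps n) /sgd; case: (eps n) => /=; lra.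
have [+ _ _] := inv n; rewrite /y !ler_norml => /andP[? ?].
have : 0 <= (beta - 1)^-1 by rewrite invr_ge0; lra.
by move=> ?; apply/andP; split; lra.
Qed.

(** * From digit sums to frequencies *)

Lemma zeros_ratio_excess (R : realType) (eps : nat -> bool) (n : nat) :
  (0 < n)%N -> zeros_ratio R eps n = (1 - excess R eps n / n%:R) / 2.
Proof.
move=> n0; rewrite /zeros_ratio.
have nn : n%:R != 0 :> R by rewrite pnatr_eq0 -lt0n.
have -> : #|[set i : 'I_n | eps i == false]%SET|%:R =
    (\sum_(i < n) (1 - sgd R (eps i)) / 2 : R).
  rewrite cardsE -sum1_card natr_sum big_mkcond /=; apply: eq_bigr => i _.
  by rewrite unfold_in /sgd; case: (eps i) => /=; lra.
rewrite -mulr_suml sumrB sumr_const card_ord -/(excess R eps n).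
by field.
Qed.

Lemma zeros_ratio_near (R : realType) (eps : nat -> bool) (g : nat -> R) (C : R) :
  (forall n, `|excess R eps n - g n| <= C) ->
  (fun n => zeros_ratio R eps n - (1 - g n / n%:R) / 2) @ \oo --> (0 : R).
Proof.
move=> egC.
have Cn : (fun n : nat => C * n%:R^-1) @ \oo --> (0 : R).
  suff H : (fun n : nat => n%:R^-1) @ \oo --> (0 : R).
    by have := cvgM (cvg_cst C) H; rewrite mulr0; apply.
  apply/gtr0_cvgV0; last exact: cvgr_idn.
  by near=> n; rewrite ltr0n; near: n; exists 1%N.
apply: (@squeeze_cvgr _ _ _ _ (fun n : nat => - (C * n%:R^-1)) (fun n : nat => C * n%:R^-1)) => //;
  last by rewrite -oppr0; exact: cvgN.
near=> n.
have n0 : (0 < n)%N by near: n; exists 1%N.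
have nn : 0 < n%:R^-1 :> R by rewrite invr_gt0 ltr0n.
rewrite (@zeros_ratio_excess _ _ _ n0).
have := egC n; rewrite ler_norml => /andP[? ?].
by apply/andP; split; nra.
Unshelve. all: by end_near. Qed.

Lemma freq0_is_linear (R : realType) (eps : nat -> bool) (p C : R) :
  (forall n, `|excess R eps n - (1 - 2 * p) * n%:R| <= C) -> freq0_is eps p.
Proof.
move=> /zeros_ratio_near H.
rewrite /freq0_is; apply/subr_cvg0.
apply: cvg_trans H; apply: near_eq_cvg; near=> n.
have nn : n%:R != 0 :> R by rewrite pnatr_eq0 -lt0n; near: n; exists 1%N.
by rewrite /=; field.
Unshelve. all: by end_near. Qed.

(** * Potentials for the threshold rule *)

Lemma exists_steep_slope (R : realType) (a c d e : R) :
  0 < a -> 0 <= c -> 0 < d -> 0 < e ->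
  exists A : R, [/\ a <= A, c <= A * d & c <= A * e].
Proof.
move=> a0 c0 d0 e0; exists (a + c / d + c / e).
have cd : 0 <= c / d by rewrite divr_ge0// ltW.
have ce : 0 <= c / e by rewrite divr_ge0// ltW.
have [cdd cee] : c / d * d = c /\ c / e * e = c by rewrite !divfK ?gt_eqF.
split; [lra|rewrite -{1}cdd ler_pM2r//; lra|rewrite -{1}cee ler_pM2r//; lra].
Qed.

(** Let [zs = 1 / (beta + 1)], the point with [beta zs - 1 = - zs], whose orbit
    alternates between [zs] and [- zs].  [D z] bounds how far the digit sum can
    fall below its present value from [z].  Above [zs] it cannot fall: the next
    digit is 1 and the orbit lands above [- zs].  Between [- zs] and [zs] it can
    fall by 1, after which the orbit is above [zs].  After a digit 1 the orbit
    is above [m = beta t - 1], and by the last but one hypothesis two digits -1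
    from there lead above [zs]; hence the value 2.  Below [m] come only
    digits -1; there the orbit climbs by at least [1 - (beta - 1) M] per step,
    so the term [A max(0, m - z)] pays for each of them when [A] is large. *)
Lemma balanced_potential (R : realType) (beta t M : R) :
  1 < beta -> 0 <= t -> t <= (beta + 1)^-1 ->
  (- (beta + 1)^-1 - 1) / beta < beta * t - 1 -> (beta - 1) * M < 1 ->
  drift_potential beta t 0 M.
Proof.
move=> b1 t0.
(* [l2] is sent to [- zs] by the digit -1 *)
set zs := (beta + 1)^-1; set l2 := _ / beta; set m := _ - 1.
move=> tz l2m ML.
have zsE : beta * zs - 1 = - zs by rewrite /zs; field; lra.
have l2E : beta * l2 + 1 = - zs by rewrite /l2; field; lra.
have zs0 : 0 < zs by rewrite invr_gt0; lra.
have [A [A0 Ag Ah]] : exists A : R,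
    [/\ 1 <= A, 1 <= A * (1 - (beta - 1) * M) & 1 <= A * (m - l2)].
  by apply: exists_steep_slope; lra.
pose D z := if zs <= z then 0 else if - zs <= z then 1 else 2 + A * Num.max 0 (m - z).
exists D, (2 + A * (`|m| + M)); split=> z zM; have := zM; rewrite ler_norml => /andP[z1 z2].
  have P0 : 0 <= A * (`|m| + M) by rewrite mulr_ge0 ?addr_ge0//; lra.
  rewrite /D; case: ifP => _; first by rewrite normr0; lra.
  case: ifP => _; first by rewrite normr1; lra.
  have mx0 : 0 <= Num.max 0 (m - z) by rewrite le_max lexx.
  rewrite ger0_norm; last by rewrite addr_ge0// mulr_ge0//; lra.
  rewrite lerD2l ler_pM2l ?ge_max; last lra.
   have := ler_norm m; have := normr_ge0 m.
  by move=> ? ?; apply/andP; split; lra.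
have D1 y : - zs <= y -> D y <= 1 by rewrite /D => ->; case: ifP => _; lra.
have D2 y : m <= y -> D y <= 2.
  rewrite /D => my; rewrite max_l ?mulr0 ?addr0; last lra.
  by case: ifP => _; [|case: ifP => _]; lra.
rewrite subr0 /sgd {2}/D.
have [zsz|zsz] := leP zs z.
  by rewrite (le_trans tz zsz) add0r; apply: D1; nra.
have [zsz'|zsz'] := leP (- zs) z.
  case: (leP t z) => tz'.
    have m1 : m <= beta * z - 1 by rewrite /m; nra.
    by have := D2 _ m1; lra.
  by rewrite /D ifT; [lra|nra].
have -> : (t <= z) = false by apply/negbTE; rewrite -ltNge; lra.
have mx0 : 0 <= Num.max 0 (m - z) by rewrite le_max lexx.
have [zz|zz] := leP (- zs) (beta * z - -1).
  by have := D1 _ zz; nra.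
have zz' : beta * z - -1 < zs by lra.
rewrite /D [zs <= _]leNgt zz' [- zs <= _]leNgt zz /=.
have zl2 : z < l2 by nra.
rewrite [X in _ <= _ + _ * X + _]max_r; last lra.
have [mz|mz] := leP (m - (beta * z - -1)) 0; first by nra.
have zg : 1 - (beta - 1) * M <= beta * z + 1 - z by nra.
have : 0 <= A * (beta * z + 1 - z - (1 - (beta - 1) * M)) by rewrite mulr_ge0; lra.
by lra.
Qed.

(** As [d = beta z - z'], the digit sum is [beta - 1] times the sum of the orbit
    points, up to a bounded term; that term is the [- z] in [D].  It remains to
    see that orbit points have a positive mean.  For [t] above the alternating
    point [1 / (beta + 1)] every point in [[m, t)], with [m = beta t - 1], is
    sent into [[t, +oo)], and points of the two kinds average at least
    [(m + t) / 2 > 0] over such pairs: the step function of height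
    [(beta - 1) (t - m) / 2] transfers the surplus from one to the other.  Below
    [m] the term [A max(0, m - z)] acts as in [balanced_potential]. *)
Lemma drifting_potential (R : realType) (beta t M : R) :
  1 < beta -> 0 <= t -> (beta + 1)^-1 < t -> beta * t + 1 <= M -> (beta - 1) * M < 1 ->
  drift_potential beta t ((beta - 1) * ((beta + 1) * t - 1) / 2) M.
Proof.
move=> b1 t0 zt tM ML.
set q := _ / 2.
have zt' : 1 < (beta + 1) * t.
  have : (beta + 1) * (beta + 1)^-1 = 1 by rewrite divff//; lra.
  by nra.
pose m := beta * t - 1.
have mt : m < t by rewrite /m; nra.
pose b := (beta - 1) * (t - m) / 2.
(* [l1] is sent to [t] by the digit -1: a point that the digit -1 leaves
   below [t] is below [l1], hence at least [m - l1] below [m] *)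
pose l1 := (t - 1) / beta.
have l1E : beta * l1 + 1 = t by rewrite /l1; field; lra.
have l1m : l1 < m by rewrite /m; nra.
pose c := q + (beta - 1) * M.
have q0 : 0 < q by rewrite /q divr_gt0// mulr_gt0; lra.
have b0 : 0 < b by rewrite /b divr_gt0// mulr_gt0; lra.
have bt0 : 0 <= beta * t by rewrite mulr_ge0//; lra.
have c0 : 0 < c.
  by rewrite /c addr_gt0// mulr_gt0//; lra.
have [A [A0 Ag Ah]] : exists A : R,
    [/\ beta <= A, c <= A * (1 - (beta - 1) * M) & c <= A * (m - l1)].
  by apply: exists_steep_slope; lra.
pose D z := - z + (if z < t then b else 0) + A * Num.max 0 (m - z).
exists D, (M + b + A * (`|m| + M)); split=> z zM; have := zM; rewrite ler_norml => /andP[z1 z2].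
  have mx0 : 0 <= A * Num.max 0 (m - z) by rewrite mulr_ge0 ?le_max ?lexx//; lra.
  have mx1 : A * Num.max 0 (m - z) <= A * (`|m| + M).
    rewrite ler_pM2l ?ge_max; last lra.
    have := ler_norm m; have := normr_ge0 m.
    by move=> ? ?; apply/andP; split; lra.
  rewrite /D ler_norml; case: ifP => _; apply/andP; split; lra.
have mx0 : 0 <= Num.max 0 (m - z) by rewrite le_max lexx.
rewrite /D /sgd; case: (leP t z) => tz.
  rewrite [Num.max _ (m - (beta * z - 1))]max_l; last by rewrite /m; nra.
  have Amx : 0 <= A * Num.max 0 (m - z) by rewrite mulr_ge0//; lra.
  have tz1 : 0 <= (beta - 1) * (z - t) by rewrite mulr_ge0; lra.
  have bq : b + q = (beta - 1) * t by rewrite /b /q /m; field.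
  by move: (A * _) Amx => X X0; case: (ltP _ t) => _; lra.
have bq : b - q = (1 - beta) * m by rewrite /b /q /m; field.
have [zm|zm] := leP m z.
  rewrite [Num.max _ (m - z)]max_l; last lra.
  rewrite max_l; last by nra.
  rewrite ifF; last by apply/negbTE; rewrite -leNgt; nra.
  have zm1 : 0 <= (beta - 1) * (z - m) by rewrite mulr_ge0; lra.
  by lra.
rewrite [Num.max _ (m - z)]max_r; last lra.
have [tz'|tz'] := ltP (beta * z - -1) t; last first.
  rewrite max_l; last lra.
  have : 0 <= (A - (beta - 1)) * (m - z) by rewrite mulr_ge0; lra.
  by lra.
rewrite /c in Ah Ag.
have Mz : 0 <= (beta - 1) * (M + z) by rewrite mulr_ge0; lra.
have [mz'|mz'] := leP (m - (beta * z - -1)) 0.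
  have zl1 : z < l1 by nra.
  have : 0 <= A * (l1 - z) by rewrite mulr_ge0; lra.
  by lra.
have : 0 <= A * (beta * z + 1 - z - (1 - (beta - 1) * M)) by rewrite mulr_ge0; lra.
by lra.
Qed.

(** * The Komornik-Loreti constant is at most the root of the cubic *)

(** The wrong digit would throw the orbit out of [[0, 1 / (beta - 1)]], where
    the orbit of any expansion has to stay. *)
Lemma forced_digits_unique (R : realType) (beta : R) (eps : nat -> bool)
    (y : nat -> R) :
  1 < beta -> (forall n, y n.+1 = beta * y n - (eps n)%:R) ->
  (forall n, 0 <= y n <= (beta - 1)^-1) ->
  (forall n, if eps n then (beta - 1)^-1 < beta * y n else beta * y n < 1) ->
  exists! e : nat -> bool, beta_expansion beta (y 0%N) e.
Proof.
move=> b1 yS yL yF; exists eps; split.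
  apply: (@orbit_beta_expansion _ _ _ _ (beta - 1)^-1 b1 yS) => n.
  by have /andP[? ?] := yL n; rewrite ger0_norm.
move=> e ex; have [w [w0 wS wL]] := @beta_expansion_orbit _ _ _ _ b1 ex.
have dig n : w n = y n -> e n = eps n.
  move=> wy; have /andP[] := wL n.+1; rewrite wS wy; have := yF n.
  by case: (eps n); case: (e n) => //=; lra.
have wy n : w n = y n.
  by elim: n => // n IH; rewrite wS yS IH (dig _ IH).
by apply/funext => n; rewrite dig.
Qed.

(** The orbit of 1 under the digits [1 1 0 1 0 1 ...] is
    [1, r - 1, u, r u, u, r u, ...] with [u = r ^ 2 - r - 1]; the cubic equation
    says that this closes up, that is [r ^ 2 u - 1 = u]. *)
Lemma univoque_base_cubic (R : realType) (r : R) :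
  1 < r < 2 -> r ^+ 3 - r ^+ 2 - 2 * r + 1 = 0 -> univoque_bases R r.
Proof.
move=> r12 rE; split=> //; case/andP: r12 => r1 r2.
pose eps n := (n < 2)%N || odd n.
pose u := r ^+ 2 - r - 1.
have ru : r ^+ 2 * u = 1 + u.
  have -> : r ^+ 2 * u = 1 + u + r * (r ^+ 3 - r ^+ 2 - 2 * r + 1) by rewrite /u; ring.
  by rewrite rE; ring.
have u0 : 0 < u by have : (r ^+ 2 - 1) * u = 1 by [lra | nra]; nra.
pose y n : R := match n with 0%N => 1 | 1%N => r - 1
  | k.+2 => if odd k then r * u else u end.
have Lgt v : 1 < (r - 1) * v -> (r - 1)^-1 < v.
  by move=> H; rewrite -div1r ltr_pdivrMr; lra.
have L1 : 1 < (r - 1)^-1 by rewrite invf_gt1; lra.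
have ru1 : r * u < 1 by rewrite /u in ru u0 *; nra.
apply: (@forced_digits_unique R r eps y) => //.
- by case=> [|[|k]]; rewrite /eps /y /=; [lra|rewrite /u; lra|case: (odd k) => /=; lra].
- have L2 : r * 1 < r * (r - 1)^-1 by rewrite ltr_pM2l; lra.
  by case=> [|[|k]]; rewrite /y /=; [| |case: (odd k)]; apply/andP; split; nra.
- by case=> [|[|k]]; rewrite /eps /y /=; [| |case: (odd k)]; rewrite /= ?negbK; try apply: Lgt; rewrite /u in ru u0 ru1 *; nra.
Qed.

(** At [beta] the cubic has the sign of [beta - r], because its other factor
    is positive for [beta > 1] and [r > 3 / 2]. *)
Lemma lt_beta_KL_cubic (R : realType) (beta : R) :
  1 < beta < beta_KL R -> beta ^+ 3 - beta ^+ 2 - 2 * beta + 1 < 0.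
Proof.
move=> /andP[b1 bKL].
pose p : {poly R} := 'X^3 - 'X^2 - 2%:P * 'X + 1.
have pE z : p.[z] = z ^+ 3 - z ^+ 2 - 2 * z + 1 by rewrite /p !hornerE.
have [||r /andP[r1 r2] /rootP] := @poly_ivt R p (3 / 2) 2.
- by lra.
- by rewrite !pE; apply/andP; split; lra.
rewrite pE => rE.
have r2' : r < 2 by rewrite lt_neqAle r2 andbT; apply/eqP => r2E; rewrite r2E in rE; lra.
have Ur : univoque_bases R r by apply: univoque_base_cubic => //; apply/andP; split; lra.
have : beta_KL R <= r by apply: ge_inf => //; exists 1 => z [/andP[+ _] _]; exact: ltW.
move=> KLr; have br : beta < r by lra.
have : 0 < (r - beta) * (r ^+ 2 + r * beta + beta ^+ 2 - r - beta - 2) by rewrite mulr_gt0; nra.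
by nra.
Qed.

(** * Admissible thresholds *)

(** The lower bound on [t] imposed by the last condition is compatible with the
    bound [t <= 1 / (beta + 1)] always, and with the bound imposed by the third
    condition exactly when the cubic is negative. *)
Lemma balanced_threshold (R : realType) (beta : R) :
  1 < beta -> beta ^+ 3 - beta ^+ 2 - 2 * beta + 1 < 0 ->
  exists t : R, [/\ 0 <= t, t <= (beta + 1)^-1, (beta - 1) * (beta * t + 1) < 1
    & (- (beta + 1)^-1 - 1) / beta < beta * t - 1].
Proof.
move=> b1 bc.
have b2 : beta < 2 by nra.
pose lo : R := Num.max 0 ((beta ^+ 2 - 2) / (beta ^+ 2 * (beta + 1))).
pose hi : R := Num.min (beta + 1)^-1 ((2 - beta) / (beta * (beta - 1))).
have bb : 0 < beta * (beta - 1) by rewrite mulr_gt0; lra.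
have bbb : 0 < beta ^+ 2 * (beta + 1) by rewrite mulr_gt0 ?exprn_gt0; lra.
have lohi : lo < hi.
  rewrite /lo /hi gt_max !lt_min invr_gt0 divr_gt0//; last lra.
  rewrite ltr_pdivrMr// ltr_pdivrMr//.
  have -> : (beta + 1)^-1 * (beta ^+ 2 * (beta + 1)) = beta ^+ 2 by field; lra.
  have -> : (2 - beta) / (beta * (beta - 1)) * (beta ^+ 2 * (beta + 1)) =
     (2 - beta) * beta * (beta + 1) / (beta - 1) by field; apply/andP; split; lra.
  rewrite ltr_pdivlMr; last lra.
  apply/andP; split; first by rewrite ?andbT; lra.
  by apply/andP; split; nra.
exists ((lo + hi) / 2).
have : 0 <= lo by rewrite le_max lexx.
have : hi <= (beta + 1)^-1 by rewrite ge_min lexx.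
have : hi * (beta * (beta - 1)) <= 2 - beta.
  by rewrite -ler_pdivlMr// ge_min lexx orbT.
have : beta ^+ 2 - 2 <= lo * (beta ^+ 2 * (beta + 1)).
  by rewrite -ler_pdivrMr// le_max lexx orbT.
move=> lo1 hi1 hi2 lo2; split; [lra|lra| |].
- nra.
- rewrite ltr_pdivrMr; last lra.
  have zE : (beta + 1) * (beta + 1)^-1 = 1 by rewrite divff//; lra.
  rewrite -(ltr_pM2l (x := beta + 1)); last lra.
  nra.
Qed.

(** The third condition reads [t < (2 - beta) / (beta (beta - 1))], and this
    bound exceeds [1 / (beta + 1)] exactly when [beta ^ 2 - beta - 1 < 0]. *)
Lemma drifting_threshold (R : realType) (beta : R) :
  1 < beta < golden_ratio R ->
  exists t : R, [/\ 0 <= t, (beta + 1)^-1 < t & (beta - 1) * (beta * t + 1) < 1].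
Proof.
move=> /andP[b1 bg].
have g : beta ^+ 2 - beta - 1 < 0.
  have s0 : 0 <= Num.sqrt 5 :> R by rewrite sqrtr_ge0.
  have s5 : Num.sqrt 5 ^+ 2 = 5 :> R by rewrite sqr_sqrtr.
  by rewrite /golden_ratio in bg; nra.
have b2 : beta < 2 by nra.
have zE : (beta + 1) * (beta + 1)^-1 = 1 by rewrite divff//; lra.
have z0 : 0 < (beta + 1)^-1 by rewrite invr_gt0; lra.
pose hi : R := (2 - beta) / (beta * (beta - 1)).
have bb : 0 < beta * (beta - 1) by rewrite mulr_gt0; lra.
have hiE : hi * (beta * (beta - 1)) = 2 - beta by rewrite divfK// gt_eqF.
have zhi : (beta + 1)^-1 < hi.
  rewrite ltr_pdivlMr// -(ltr_pM2l (x := beta + 1)); last lra.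
  by rewrite mulrA zE; lra.
exists (((beta + 1)^-1 + hi) / 2); split; [lra|lra|nra].
Qed.

(** * A Lipschitz target without mean *)

(** The distance to [{0} U {2 ^ k}] vanishes at [2 ^ k] and is at least a third
    of [n] at [n = 3 * 2 ^ k]. *)
Lemma ratio_to_powers_of_2 (R : realType) :
  exists h : nat -> R, [/\ h 0%N = 0, forall n, `|h n.+1 - h n| <= 1
    & ~ exists l : R, (fun n => h n / n%:R) @ \oo --> l].
Proof.
pose E (n : nat) : set R := [set x | x = n%:R \/ exists k, x = `|n%:R - (2 ^ k)%:R|].
pose h n := inf (E n).
have E0 n : E n !=set0 by exists n%:R; left.
have lbE n : has_lbound (E n).
  by exists 0 => x [->|[k ->]]; rewrite ?ler0n ?normr_ge0.
have h0 n : 0 <= h n.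
  by apply: lb_le_inf => // x [->|[k ->]]; rewrite ?ler0n ?normr_ge0.
have hle n x : E n x -> h n <= x by move=> Ex; apply: ge_inf.
have hp k : h (2 ^ k)%N = 0.
  by apply/eqP; rewrite eq_le h0 andbT; apply: hle; right; exists k; rewrite subrr normr0.
have hL m n : `|m%:R - n%:R : R| <= 1 -> h m <= h n + 1.
  move=> mn; rewrite -lerBlDr; apply: lb_le_inf => // x; rewrite lerBlDr => -[->|[k ->]].
    apply: (@le_trans _ _ m%:R); first by apply: hle; left.
    by move: mn; rewrite ler_norml => /andP[? ?]; lra.
  apply: (@le_trans _ _ `|m%:R - (2 ^ k)%:R|); first by apply: hle; right; exists k.
  by rewrite [leRHS]addrC (le_trans (ler_distD n%:R _ _))// lerD2r.
have h3 k : (2 ^ k)%:R <= h (3 * 2 ^ k)%N.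
  apply: lb_le_inf => // x [->|[j ->]]; first by rewrite ler_nat leq_pmull.
  have [jk|kj] := leqP j k.+1.
    have : (2 ^ j)%:R <= (2 * 2 ^ k)%:R :> R by rewrite ler_nat -expnS leq_exp2l.
    by rewrite !natrM => ?; rewrite ler_normr; apply/orP; left; lra.
  have : (2 * (2 * 2 ^ k))%:R <= (2 ^ j)%:R :> R by rewrite ler_nat -!expnS leq_exp2l.
  by rewrite !natrM => ?; rewrite ler_normr; apply/orP; right; lra.
exists h; split.
- by apply/eqP; rewrite eq_le h0 andbT; apply: hle; left.
- move=> n.
  have := hL n.+1 n; have := hL n n.+1; rewrite distrC -natr1 addrAC subrr add0r normr1.
  by move=> /(_ (lexx _)) ? /(_ (lexx _)) ?; rewrite ler_norml; apply/andP; split; lra.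
move=> [l /cvgr_dist_lt /(_ 9^-1)] [|N _ hN]; first by lra.
have NN : (N <= 2 ^ N)%N by rewrite ltnW// ltn_expl.
have p0 : 0 < (2 ^ N)%:R :> R by rewrite ltr0n expn_gt0.
have := hN _ NN; have := hN (3 * 2 ^ N)%N (leq_trans NN (leq_pmull _ (isT : 0 < 3)%N)).
rewrite /= hp mul0r !ltr_norml => /andP[+ _] /andP[_ +].
have : 3^-1 <= h (3 * 2 ^ N)%N / (3 * 2 ^ N)%:R.
  by rewrite ler_pdivlMr ?natrM ?mulr_gt0// mulrA mulVf// mul1r.
by lra.
Qed.

(** * The three statements *)

Lemma steering_lt_golden (R : realType) (beta : R) :
  1 < beta < golden_ratio R ->
  exists2 q : R, 0 < q & forall (g : nat -> R) (x : R),
    g 0%N = 0 -> (forall n, `|g n.+1 - g n| <= q) -> 0 < x < (beta - 1)^-1 ->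
    exists eps : nat -> bool, beta_expansion beta x eps /\
      exists C : R, forall n, `|excess R eps n - g n| <= C.
Proof.
move=> bg; have [t [t0 zt tL]] := @drifting_threshold _ _ bg; have /andP[b1 _] := bg.
have bt : 1 < (beta + 1) * t by rewrite mulrC -ltr_pdivrMr ?div1r//; lra.
have q0 : 0 < (beta - 1) * ((beta + 1) * t - 1) / 2.
  by rewrite divr_gt0// mulr_gt0; lra.
exists ((beta - 1) * ((beta + 1) * t - 1) / 2) => // g x g0 gL xL.
apply: (@steering _ _ t _ g x b1 t0 (ltW q0) tL _ g0 gL xL) => M tM ML.
exact: drifting_potential.
Qed.

Theorem theorem2p1 (R : realType) :
  (forall beta : R, 1 < beta < beta_KL R ->
     forall x : R, 0 < x < (beta - 1)^-1 ->
       exists eps : nat -> bool,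
         beta_expansion beta x eps /\ simply_normal R eps) /\
  (forall beta : R, 1 < beta < golden_ratio R ->
     forall x : R, 0 < x < (beta - 1)^-1 ->
       exists eps : nat -> bool,
         beta_expansion beta x eps /\ ~ freq0_exists R eps) /\
  (forall beta : R, 1 < beta < golden_ratio R ->
     exists2 c : R, 0 < c &
       forall x : R, 0 < x < (beta - 1)^-1 ->
       forall p : R, 2^-1 - c <= p <= 2^-1 + c ->
         exists eps : nat -> bool,
           beta_expansion beta x eps /\ freq0_is eps p).
Proof.
split; [|split].
- move=> beta bKL x xL; have /andP[b1 _] := bKL.
  have [t [t0 tz tL lt2]] := balanced_threshold b1 (lt_beta_KL_cubic bKL).
  have pot M : beta * t + 1 <= M -> (beta - 1) * M < 1 -> drift_potential beta t 0 M.
    by move=> _; exact: balanced_potential.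
  have g0 (n : nat) : `|0 - 0 : R| <= 0 by rewrite subrr normr0.
  have [eps [ex [C eC]]] :=
    @steering _ _ t 0 (fun=> 0) x b1 t0 (lexx 0) tL pot erefl g0 xL.
  exists eps; split=> //; apply: (@freq0_is_linear _ _ _ C) => n.
  by rewrite divff ?pnatr_eq0// subrr mul0r.
- move=> beta bg x xL; have [q q0 st] := steering_lt_golden bg.
  have [h [h0 hL hN]] := ratio_to_powers_of_2 R.
  have [||eps [ex [C eC]]] := st (fun n => q * h n) x _ _ xL.
  + by rewrite h0 mulr0.
  + by move=> n; rewrite -mulrBr normrM gtr0_norm// ler_piMr// ltW.
  exists eps; split=> // -[p fp]; apply: hN.
  exists (q^-1 - 2 / q * p).
  have gp : (fun n => (1 - q * h n / n%:R) / 2) @ \oo --> p.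
    rewrite -[p]subr0; apply: cvg_trans (cvgB fp (zeros_ratio_near eC)).
    by apply: near_eq_cvg; apply: nearW => n; rewrite !fctE subKr.
  apply: cvg_trans (cvgB (cvg_cst (q^-1 : R)) (cvgM (cvg_cst (2 / q : R)) gp)).
  apply: near_eq_cvg; near=> n.
  have n0 : n%:R != 0 :> R by rewrite pnatr_eq0 -lt0n; near: n; exists 1%N.
  by rewrite !fctE /=; field; rewrite n0 gt_eqF.
- move=> beta bg; have [q q0 st] := steering_lt_golden bg.
  exists (q / 2) => [|x xL p pc]; first by rewrite divr_gt0.
  have [||eps [ex [C eC]]] := st (fun n => (1 - 2 * p) * n%:R) x _ _ xL.
  + by rewrite mulr0.
  + move=> n; rewrite -mulrBr -(natr1 n) addrAC subrr add0r mulr1 ler_norml.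
    by move: pc => /andP[? ?]; apply/andP; split; lra.
  by exists eps; split=> //; exact: freq0_is_linear eC.
Unshelve. all: by end_near. Qed.
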